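(* Let $(E,(P_t)_{t\ge 0},obs)$ be a continuous-time Markov process (CTMP) and fix a discount factor $0<c<1$. Define $\delta^c_0(x,y)=|obs(x)-obs(y)|$, $\delta^c_{n+1}=\mathcal{F}_c(\delta^c_n)$ for $n\ge 0$, and $\overline{\delta}^c=\sup_n \delta^c_n$ (pointwise). Then $\overline{\delta}^c$ is a fixpoint of $\mathcal{F}_c$, i.e. $\mathcal{F}_c(\overline{\delta}^c)=\overline{\delta}^c$.
   Context: $E$ is a locally compact Hausdorff space with a countable base, equipped with its Borel $\sigma$-algebra; $E$ is then Polish, with topology $\mathcal{O}$ generated by a 1-bounded metric $\Delta$. $C_0(E)$ is the Banach space (sup norm) of continuous real functions on $E$ vanishing at infinity. A CTMP consists of: a strongly continuous semigroup $(\hat P_t)_{t\ge 0}$ of bounded linear operators on $C_0(E)$ ($\hat P_0=I$, $\hat P_s\hat P_t=\hat P_{s+t}$) with $0\le f\le 1 \Rightarrow 0\le \hat P_t f\le 1$; the associated Markov kernels $P_t$ with $\hat P_t f(x)=\int f(y)\,P_t(x,\mathrm{d}y)$ for $f\in C_0(E)$, which are honest: $P_t(x,E)=1$ for all $x,t$ (write $P_t(x)$ for the probability measure $P_t(x,\cdot)$); a continuous function $obs:E\to[0,1]$; and the property that if $x_n\to x$ in $E$ then $P_t(x_n)\to P_t(x)$ weakly for every $t\ge0$. For Borel probability measures $\mu,\nu$ on $E$, $\Gamma(\mu,\nu)$ is the set of couplings (probability measures on $E\times E$ with marginals $\mu,\nu$), and for a lower semicontinuous $m:E\times E\to[0,1]$,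 $W(m)(\mu,\nu)=\inf_{\gamma\in\Gamma(\mu,\nu)}\int m\,\mathrm{d}\gamma$. $\mathcal{P}$ denotes the set of 1-bounded pseudometrics on $E$ that are lower semicontinuous as functions $E\times E\to[0,1]$ (w.r.t. $\mathcal{O}$). For $m\in\mathcal{P}$, $\mathcal{F}_c(m)(x,y)=\sup_{t\ge 0} c^t\, W(m)(P_t(x),P_t(y))$. (Each $\delta^c_n$ is a continuous pseudometric, so the recursion is well defined.) *)

(* Defs.v *)
From HB Require Import structures.
From mathcomp Require Import all_boot all_order all_algebra.
From mathcomp Require Import all_classical all_reals all_analysis.

Set Implicit Arguments.
Unset Strict Implicit.
Unset Printing Implicit Defensive.

Import Order.TTheory GRing.Theory Num.Theory.
Import numFieldNormedType.Exports.

Local Open Scope classical_set_scope.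
Local Open Scope ring_scope.

Notation borel E := (g_sigma_algebraType (@open E)).

Section C0.
Context {R : realType} {E : ptopologicalType}.
Implicit Types f g : E -> R.

Definition C0 : set (E -> R) := [set f | continuous f /\
  forall e : R, 0 < e ->
    exists2 K : set E, compact K & forall x, ~ K x -> `|f x| < e].

Definition supnorm f : R := sup [set `|f x| | x in [set: E]].

Definition bounded_operator_C0 (A : (E -> R) -> (E -> R)) : Prop :=
  [/\ forall f, C0 f -> C0 (A f),
      forall (a : R) f g, C0 f -> C0 g ->
        A (fun x => a * f x + g x) = (fun x => a * A f x + A g x) &
      exists M : R, forall f, C0 f -> supnorm (A f) <= M * supnorm f].

(* The operators are total functions on E -> R and the time index ranges over
   R; only their values on C0 and at times t >= 0 are constrained or used. *)
Record sub_Markov_C0_semigroup (T : R -> (E -> R) -> (E -> R)) : Prop := {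
  semigroup_bounded : forall t, 0 <= t -> bounded_operator_C0 (T t) ;
  semigroup0 : forall f, C0 f -> T 0 f = f ;
  semigroupD : forall s t f, 0 <= s -> 0 <= t -> C0 f ->
    T s (T t f) = T (s + t) f ;
  semigroup_strongly_continuous : forall f, C0 f ->
    supnorm (fun x => T t f x - f x) @[t --> 0^'+] --> (0 : R) ;
  semigroup_sub_Markov : forall t f, 0 <= t -> C0 f ->
    (forall x, 0 <= f x <= 1) -> forall x, 0 <= T t f x <= 1 }.

End C0.

Definition weak_cvg {R : realType} {E : ptopologicalType}
    (mu_ : nat -> {measure set (borel E) -> \bar R})
    (mu : {measure set (borel E) -> \bar R}) : Prop :=
  forall f : E -> R, continuous f -> (exists M : R, forall x, `|f x| <= M) ->
    \int[mu_ n]_x f x @[n --> \oo] --> \int[mu]_x f x.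

Record CTMP (R : realType) (E : ptopologicalType) := {
  ctmp_semigroup : R -> (E -> R) -> (E -> R) ;
  ctmp_kernel : R -> R.-pker (borel E) ~> (borel E) ;
  ctmp_obs : E -> R ;
  ctmp_semigroupP : sub_Markov_C0_semigroup ctmp_semigroup ;
  ctmp_kernelE : forall t f x, 0 <= t -> C0 f ->
    ctmp_semigroup t f x = \int[ctmp_kernel t x]_y f y ;
  ctmp_obs_continuous : continuous ctmp_obs ;
  ctmp_obs01 : forall x, 0 <= ctmp_obs x <= 1 ;
  ctmp_kernel_cvg : forall (t : R) (x_ : nat -> E) (x : E), 0 <= t ->
    x_ @ \oo --> x ->
    weak_cvg (fun n => ctmp_kernel t (x_ n)) (ctmp_kernel t x) }.

Section transport.
Context {R : realType} {E : ptopologicalType}.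
Implicit Types (mu nu : {measure set (borel E) -> \bar R}) (m : E -> E -> R).

(* Couplings live on the product sigma-algebra, which is the Borel
   sigma-algebra of E * E since E is second countable. *)
Definition couplings mu nu : set (probability (borel E * borel E)%type R) :=
  [set gamma | forall A : set (borel E), measurable A ->
    gamma (fst @^-1` A) = mu A /\ gamma (snd @^-1` A) = nu A].

Definition W m mu nu : R :=
  inf [set \int[gamma]_z m z.1 z.2 | gamma in couplings mu nu].

Context (X : CTMP R E) (c : R).

(* Fc is total, but agrees with the intended functional only on [0, 1]-valued
   lower semicontinuous m, for which the integrals, inf and sup in W and Fc
   are meaningful; delta n and delta_bar are of this kind. *)
Definition Fc m : E -> E -> R := fun x y =>
  sup [set c `^ t * W m (ctmp_kernel X t x) (ctmp_kernel X t y)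
      | t in [set t : R | 0 <= t]].

Fixpoint delta (n : nat) : E -> E -> R :=
  if n is n'.+1 then Fc (delta n')
  else fun x y => `|ctmp_obs X x - ctmp_obs X y|.

Definition delta_bar : E -> E -> R := fun x y =>
  sup [set delta n x y | n in [set: nat]].

End transport.

(* Main.v *)
(** The only analytic input is compactness of couplings. Given weakly convergent
marginals and couplings [gamma_n] of them, take limits along an ultrafilter
[U]: [lam K := lim_U gamma_n K] is a finitely additive content on compact sets,
and Halmos' regularisation [inf_(G open, A c G) sup_(K compact, K c G) lam K]
is a Borel measure. It is a probability because the marginals are tight, it is
a coupling of the limit marginals, and it does not exceed [lam] on open sets,
so that integrating a lower semicontinuous cost against it gives at most the
limit of the integrals against [gamma_n].

Consequently [W m] is lower semicontinuous in the marginals, whence every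
[delta n] is lower semicontinuous, and [W] commutes with suprema of increasing
sequences of lower semicontinuous costs. Since [P_0 x] is the Dirac measure at
[x], [delta 0 <= delta 1], the sequence [delta n] is increasing, and exchanging
the two suprema gives the fixpoint equation. *)

Require Import Defs.
From HB Require Import structures.
From mathcomp Require Import all_boot all_order all_algebra.
From mathcomp Require Import all_classical all_reals all_analysis.
From mathcomp Require Import measurable_realfun lra.
Import Order.TTheory GRing.Theory Num.Theory.
Import numFieldNormedType.Exports.
Local Open Scope classical_set_scope.
Local Open Scope ring_scope.

(** * Separation and covering of compact sets *)

(** The near-covering form of compactness, run along the small members of [F], yields one [U] that
    works for all points of [A]; [W] is the union of all open sets disjoint from it. A general
    filter allows two uses: separating a point from a compact set, then two compact sets. *)
Lemma compact_filter_separation {T : topologicalType} (A : set T)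
    (F : set_system T) : compact A -> ProperFilter F ->
  (forall a, A a -> exists V U, [/\ nbhs a V, F U & V `&` U = set0]) ->
  exists W U, [/\ open W, A `<=` W, F U & W `&` U = set0].
Proof.
move=> /compact_near_coveringP cA FF sepA.
have PF := @powerset_filter_from_filter _ F FF.
have cvP x : A x -> \forall x' \near x & U \near powerset_filter_from F,
    exists V, [/\ open V, V x' & V `&` U = set0].
  move=> /sepA[V [U [Vx FU VU0]]].
  near=> x' U'.
  exists V°; split; first exact: open_interior.
    by near: x'; exact: nbhs_interior.
  rewrite -subset0 => y [/interior_subset Vy U'y]; rewrite -VU0; split=> //.
  suff : U' `<=` U by apply.
  exact: (near (small_set_sub FU) U').
have [G [GF Gmono [U GU] GA]] := cA _ _ _ _ cvP.
exists (\bigcup_(V in [set V | open V /\ V `&` U = set0]) V), U; split.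
- by apply: bigcup_open => V [].
- by move=> x Ax; have [V [oV Vx VU]] := GA _ GU _ Ax; exists V.
- exact: GF.
- by rewrite -subset0 => x [[V [_ <-]] Vx Ux].
Unshelve. all: by end_near. Qed.

Lemma hausdorff_compact_separation {T : topologicalType} (A B : set T) :
  hausdorff_space T -> compact A -> compact B -> A `&` B = set0 ->
  exists U V, [/\ open U, open V, A `<=` U, B `<=` V & U `&` V = set0].
Proof.
rewrite open_hausdorff => hT cA cB AB0.
have sepAb b : B b -> exists W U, [/\ open W, A `<=` W, nbhs b U & W `&` U = set0].
  move=> Bb; apply: compact_filter_separation => // a Aa.
  have /hT[[U V] /= []] : a != b.
    by apply/eqP => ab; rewrite -[False]/(set0 b) -AB0; split => //; rewrite -ab.
  rewrite !inE => Ua Vb [oU oV UV0]; exists U, V; split=> //.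
  - exact: open_nbhs_nbhs.
  - exact: open_nbhs_nbhs.
(* [set_nbhs A] is a proper filter only for nonempty [A]. *)
have [A0|/set0P A0] := eqVneq A set0.
  exists set0, setT; rewrite A0; split => //; [exact: open0|exact: openT|exact: set0I].
have PA : ProperFilter (set_nbhs A).
  by exact: set_nbhs_pfilter.
have [|W [U [oW BW /set_nbhsP[C [oC AC CU]] WU0]]] :=
    @compact_filter_separation _ B (set_nbhs A) cB _.
  move=> b /sepAb[W [U [oW AW Ub WU0]]]; exists U, W; split.
  - exact: Ub.
  - by apply/set_nbhsP; exists W; split.
  - by rewrite setIC.
exists C, W; split => //; rewrite setIC.
exact: subsetI_eq0 WU0.
Qed.

(** The parts of [K] outside [G1] and outside [G2] are disjoint compact sets, hence have disjoint
    open neighbourhoods [U] and [V]. Removing [U], respectively [V], from [K] leaves the two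
    pieces. *)
Lemma compact_setU_split {T : topologicalType} (K G1 G2 : set T) :
  hausdorff_space T -> compact K -> open G1 -> open G2 -> K `<=` G1 `|` G2 ->
  exists K1 K2, [/\ compact K1, compact K2, K1 `<=` G1, K2 `<=` G2 &
    K = K1 `|` K2].
Proof.
move=> hT cK oG1 oG2 KG.
have cD (G : set T) : open G -> compact (K `\` G).
  by move=> oG; apply: compact_closedI => //; exact: open_closedC.
have [|U [V [oU oV K1U K2V UV0]]] :=
    hausdorff_compact_separation _ _ hT (cD _ oG1) (cD _ oG2).
  by rewrite -subset0 => x [[Kx nG1] [_ nG2]]; case: (KG _ Kx).
exists (K `\` U), (K `\` V); split.
- exact: cD.
- exact: cD.
- by move=> x [Kx nU]; apply: contrapT => nG; apply: nU; exact: K1U.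
- by move=> x [Kx nU]; apply: contrapT => nG; apply: nU; exact: K2V.
- by rewrite -setDIr UV0 setD0.
Qed.

Lemma compact_sub_bigsetU {T : topologicalType} (K : set T) (G : (set T)^nat) :
  compact K -> (forall n, open (G n)) -> K `<=` \bigcup_n G n ->
  exists n, K `<=` \big[setU/set0]_(i < n) G i.
Proof.
move=> /compact_near_coveringP cK oG KG.
have [|n _ /(_ n (leqnn n)) Kn] :=
    cK nat \oo (fun n => \big[setU/set0]_(i < n) G i) _.
  move=> x /KG[i _ Gix]; near=> x' n.
  rewrite -bigcup_mkord; exists i => /=; first by near: n; exists i.+1.
  by near: x'; apply: open_nbhs_nbhs; split.
by exists n.
Unshelve. all: by end_near. Qed.

(** * Measures from contents on compact sets *)

Section content_measure.
Context {R : realType} {Z : ptopologicalType} (hZ : hausdorff_space Z).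
Variable lam : set Z -> R.
Hypothesis lam_ge0 : forall K, compact K -> 0 <= lam K.
Hypothesis lam_le1 : forall K, compact K -> lam K <= 1.
Hypothesis lam_U : forall K L, compact K -> compact L ->
  lam (K `|` L) <= lam K + lam L.
Hypothesis lam_disjU : forall K L, compact K -> compact L -> K `&` L = set0 ->
  lam K + lam L <= lam (K `|` L).

Local Open Scope ereal_scope.

Definition content_inner (G : set Z) : \bar R :=
  ereal_sup [set (lam K)%:E | K in [set K | compact K /\ K `<=` G]].

Definition content_outer (A : set Z) : \bar R :=
  ereal_inf [set content_inner G | G in [set G | open G /\ A `<=` G]].

Local Notation tau := content_inner.
Local Notation gam := content_outer.

(** The empty set is disjoint from itself, so [lam_disjU] bounds twice its content by its
    content. *)
Let lam0 : lam set0 = 0%R.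
Proof.
have c0 := @compact0 Z.
by apply/eqP; rewrite eq_le lam_ge0// andbT; have := lam_disjU _ _ c0 c0 (setI0 _);
  rewrite setU0; lra.
Qed.

Lemma content_inner_ge K G : compact K -> K `<=` G -> (lam K)%:E <= tau G.
Proof. by move=> cK KG; apply: ereal_sup_ubound; exists K => //; split. Qed.

Lemma content_inner_ge0 G : 0 <= tau G.
Proof.
by have := content_inner_ge _ G (@compact0 Z) (@sub0set _ G); rewrite lam0.
Qed.

Lemma content_inner_le1 G : tau G <= 1.
Proof. by apply: ge_ereal_sup => _ [K [cK KG] <-]; rewrite lee_fin lam_le1. Qed.

Lemma content_inner_fin G : tau G \is a fin_num.
Proof.
rewrite ge0_fin_numE ?content_inner_ge0//.
by rewrite (le_lt_trans (content_inner_le1 _))// ltry.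
Qed.

Lemma le_content_inner G H : G `<=` H -> tau G <= tau H.
Proof.
move=> GH; apply: ge_ereal_sup => _ [K [cK KG] <-].
by apply: content_inner_ge => //; exact: subset_trans GH.
Qed.

Lemma content_inner0 : tau set0 = 0.
Proof.
apply/eqP; rewrite eq_le content_inner_ge0 andbT.
by apply: ge_ereal_sup => x [K [cK]]; rewrite subset0 => -> <-; rewrite lam0.
Qed.

(** Splitting [K] along the last open set gives one compact piece inside it and one inside the union
    of the others; [lam_U] adds their contents. With finite subcovers this becomes countable
    subadditivity on open sets. *)
Lemma content_bigsetU (G : (set Z)^nat) n K : (forall i, open (G i)) ->
  compact K -> K `<=` \big[setU/set0]_(i < n) G i ->
  (lam K)%:E <= \sum_(i < n) tau (G i).
Proof.
move=> oG; elim: n K => [|n ih] K cK.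
  by rewrite !big_ord0 subset0 => ->; rewrite lam0.
rewrite !big_ord_recr /= => KG.
have oU : open (\big[setU/set0]_(i < n) G i).
  by rewrite -bigcup_mkord; exact: bigcup_open.
have [K1 [K2 [cK1 cK2 K1G K2G ->]]] := compact_setU_split _ _ _ hZ cK oU (oG n) KG.
apply: (@le_trans _ _ ((lam K1)%:E + (lam K2)%:E)).
  by rewrite -EFinD lee_fin lam_U.
by rewrite leeD ?ih// content_inner_ge.
Qed.

Lemma content_inner_bigcup (G : (set Z)^nat) : (forall i, open (G i)) ->
  tau (\bigcup_n G n) <= \sum_(i <oo) tau (G i).
Proof.
move=> oG; apply: ge_ereal_sup => _ [K [cK KG] <-].
have [n Kn] := compact_sub_bigsetU _ _ cK oG KG.
apply: (le_trans (content_bigsetU _ _ _ oG cK Kn)).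
rewrite -(big_mkord xpredT (fun i => tau (G i))).
by apply: nneseries_lim_ge => i *; exact: content_inner_ge0.
Qed.

Lemma content_outerE G : open G -> gam G = tau G.
Proof.
move=> oG; apply/eqP; rewrite eq_le; apply/andP; split.
  by apply: ereal_inf_lbound; exists G => //; split.
by apply: le_ereal_inf_tmp => _ [H [oH GH] <-]; exact: le_content_inner.
Qed.

Lemma content_outer_ge0 A : 0 <= gam A.
Proof. by apply: le_ereal_inf_tmp => _ [H _ <-]; exact: content_inner_ge0. Qed.

Lemma content_outer_fin A : gam A \is a fin_num.
Proof.
rewrite ge0_fin_numE ?content_outer_ge0//.
rewrite (le_lt_trans _ (ltry 1))//.
apply: le_trans (content_inner_le1 setT).
by apply: ereal_inf_lbound; exists setT => //; split => //; exact: openT.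
Qed.

Lemma content_outer0 : gam set0 = 0.
Proof. by rewrite content_outerE ?content_inner0//; exact: open0. Qed.

Lemma le_content_outer : {homo gam : A B / A `<=` B >-> A <= B}.
Proof.
move=> A B AB; apply: ereal_inf_le_tmp => _ [G [oG BG] <-].
by exists G => //; split => //; exact: subset_trans BG.
Qed.

Lemma content_outer_adherent A (e : R) : (0 < e)%R ->
  exists G, [/\ open G, A `<=` G & tau G <= gam A + e%:E].
Proof.
move=> e0.
have [_ [G [oG AG] <-] /ltW h] := lb_ereal_inf_adherent e0 (content_outer_fin A).
by exists G.
Qed.

Lemma content_outer_sigma_subadditive : sigma_subadditive gam.
Proof.
move=> A; apply/lee_addgt0Pr => e e0.
rewrite (le_trans _ (epsilon_trick _ _ _))//; last 2 first.
  by move=> n; exact: content_outer_ge0.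
  exact: ltW.
have en n : (0 < e / (2 ^ n.+1)%:R)%R by rewrite divr_gt0// ltr0n expn_gt0.
(* Each [A n] is enclosed in an open set with excess at most [e / 2 ^ n.+1]; these excesses sum to
   [e]. *)
have /choice[G PG] n := content_outer_adherent (A n) _ (en n).
apply: (@le_trans _ _ (tau (\bigcup_n G n))).
  apply: ereal_inf_lbound; exists (\bigcup_n G n) => //; split.
    by apply: bigcup_open => i _; have [] := PG i.
  by apply: subset_bigcup => i _; have [] := PG i.
apply: (@le_trans _ _ (\sum_(i <oo) tau (G i))).
  by apply: content_inner_bigcup => i; have [] := PG i.
apply: lee_nneseries => // i *; first exact: content_inner_ge0.
by have [] := PG i.
Qed.

HB.instance Definition _ := isOuterMeasure.Build R Z gam
  content_outer0 content_outer_ge0 le_content_outer content_outer_sigma_subadditive.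

(* Fill [V `&` G] from inside by a compact [K], then [V `\` K] by a compact [L]:
   [K] and [L] are disjoint compact subsets of [V]. *)
Lemma content_inner_setID V G : open V -> open G ->
  gam (V `&` G) + gam (V `&` ~` G) <= tau V.
Proof.
move=> oV oG; apply/lee_addgt0Pr => e e0.
have oVG : open (V `&` G) by exact: openI.
have [|_ [K [cK KVG] <-] hK] := @ub_ereal_sup_adherent _ _ (e / 2) _
    (content_inner_fin (V `&` G)).
  by rewrite divr_gt0.
have cK' : closed K by exact: compact_closed.
have oVK : open (V `\` K) by apply: openI => //; exact: closed_openC.
have [|_ [L [cL LVK] <-] hL] := @ub_ereal_sup_adherent _ _ (e / 2) _
    (content_inner_fin (V `\` K)).
  by rewrite divr_gt0.
rewrite -/(tau (V `\` K)) in hL; rewrite -/(tau _) in hK.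
have KL0 : K `&` L = set0 by rewrite -subset0 => x [Kx /LVK[]].
have KLV : K `|` L `<=` V by move=> x [/KVG[]|/LVK[]].
have h1 := content_inner_ge _ _ (compactU cK cL) KLV.
have h2 := lam_disjU _ _ cK cL KL0.
have h3 : gam (V `&` ~` G) <= tau (V `\` K).
  rewrite -content_outerE//; apply: le_content_outer => x [Vx nG]; split => //.
  by move=> /KVG[].
rewrite content_outerE//; apply: (le_trans (leeD (lexx _) h3)).
move: hK hL h1.
rewrite -(fineK (content_inner_fin (V `&` G))) -(fineK (content_inner_fin (V `\` K))).
rewrite -(fineK (content_inner_fin V)) -!EFinD !lte_fin !lee_fin => ? ? ?; lra.
Qed.

(** Since [gam X] is an infimum over open sets [V] containing [X], the Caratheodory inequality need
    only be checked on such [V]. *)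
Lemma content_open_caratheodory G : open G -> gam.-caratheodory G.
Proof.
move=> oG; apply: le_caratheodory_measurable => X.
apply: le_ereal_inf_tmp => _ [V [oV XV] <-].
apply: le_trans (content_inner_setID _ _ oV oG).
by apply: leeD; apply: le_content_outer; exact: setSI.
Qed.

Lemma borel_caratheodory (A : set (borel Z)) : measurable A -> gam.-caratheodory A.
Proof.
move: A; apply: smallest_sub; last exact: content_open_caratheodory.
exact: (sigma_algebra_measurable (caratheodory_type gam)).
Qed.

Lemma content_measure_sigma_additive :
  semi_sigma_additive (gam : set (borel Z) -> \bar R).
Proof.
move=> F mF tF mUF; apply: caratheodory_measure_sigma_additive => //.
- by move=> i; exact: borel_caratheodory.
- exact: borel_caratheodory.
Qed.

Lemma content_measure_ex : exists mu : {measure set (borel Z) -> \bar R},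
  forall G, open G -> mu G = tau G.
Proof.
pose mM := isMeasure.Build _ (borel Z) R gam content_outer0 content_outer_ge0
  content_measure_sigma_additive.
pose mu : {measure set (borel Z) -> \bar R} :=
  HB.pack (gam : set (borel Z) -> \bar R) mM.
by exists mu => G oG; exact: content_outerE.
Qed.

End content_measure.

(** * Second countable locally compact spaces *)

Lemma second_countable_seqP {T : topologicalType} : @second_countable T ->
  exists B : (set T)^nat, (forall n, open (B n)) /\
    forall x U, nbhs x U -> exists2 n, B n x & B n `<=` U.
Proof.
move=> [B /countable_injP[f finj] [Bo Bx]].
(* As [f] is injective on [B], this union is the single basic set numbered [n], or empty. *)
exists (fun n => \bigcup_(V in [set V | B V /\ f V = n]) V); split.
  by move=> n; apply: bigcup_open => V [/Bo].
move=> x U /Bx[V [BV Vx] VU]; exists (f V); first by exists V.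
move=> y [W [BW fWV] Wy]; apply: VU.
by rewrite (finj V W) ?inE.
Qed.

Lemma second_countable_prod {T U : topologicalType} :
  @second_countable T -> @second_countable U -> @second_countable (T * U)%type.
Proof.
move=> [B cB [oB xB]] [C cC [oC xC]].
exists [set P.1 `*` P.2 | P in B `*` C].
  by apply: sub_countable (countableX cB cC); exact: card_image_le.
split=> [_ [[V W] [/oB oV /oC oW] <-]|[x y] N].
  rewrite openE => -[a b] [/= Va Wb].
  by exists (V, W) => //; split; exact: open_nbhs_nbhs.
move=> [[V W] /= [/xB[V' [BV' V'x] V'V] /xC[W' [CW' W'y] W'W]] VWN].
exists (V' `*` W'); first by split => //; exists (V', W').
by move=> [a b] [/= /V'V Va /W'W Wb]; apply: VWN.
Qed.

(** Lindelöf argument: for every basic open set contained in some admissible [S d], one such [d] is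
    chosen. The default [d0] fills the indices of the other basic sets. *)
Lemma lindelof_choice {T : topologicalType} {D : Type} (d0 : D) (P : D -> Prop)
    (S : D -> set T) (G : set T) : @second_countable T -> P d0 ->
  (forall x, G x -> exists2 d, P d & nbhs x (S d)) ->
  exists d : nat -> D, (forall n, P (d n)) /\ G `<=` \bigcup_n S (d n).
Proof.
move=> /second_countable_seqP[B [oB xB]] Pd0 GP.
have /choice[d Pd] n : exists d, P d /\
    ((exists2 d', P d' & B n `<=` S d') -> B n `<=` S d).
  have [[d Pd Bd]|nB] := pselect (exists2 d', P d' & B n `<=` S d').
    by exists d.
  by exists d0.
exists d; split=> [n|x /GP[d' Pd' /xB[n Bnx BnS]]]; first by have [] := Pd n.
by exists n => //; apply: (Pd n).2 => //; exists d'.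
Qed.

(** By the Lindelöf argument, [G] is a countable union of open rectangles. *)
Lemma open_measurable_prod {E F : ptopologicalType} :
  @second_countable E -> @second_countable F -> forall G : set (E * F), open G ->
  measurable (G : set (borel E * borel F)).
Proof.
move=> scE scF G oG.
have [] := @lindelof_choice _ _ (set0, set0)
  (fun UV : set E * set F => [/\ open UV.1, open UV.2 & UV.1 `*` UV.2 `<=` G])
  (fun UV => UV.1 `*` UV.2) G (second_countable_prod scE scF).
- by split; [exact: open0|exact: open0|move=> [? ?] []].
- move=> [x y] Gxy; have [[U V] /= [Ux Vy] UVG] := open_nbhs_nbhs (conj oG Gxy).
  have [U' [oU' U'x] U'U] : exists2 B, open_nbhs x B & B `<=` U by move: Ux; rewrite nbhsE.
  have [V' [oV' V'y] V'V] : exists2 B, open_nbhs y B & B `<=` V by move: Vy; rewrite nbhsE.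
  exists (U', V').
    by split => //= -[a b] [/= /U'U Ua /V'V Vb]; apply: UVG.
  by exists (U', V') => //; split; exact: open_nbhs_nbhs.
move=> UV [PUV GUV].
suff -> : G = \bigcup_n ((UV n).1 `*` (UV n).2).
  apply: bigcupT_measurable => n; have [? ? _] := PUV n.
  by apply: measurableX; exact: sub_sigma_algebra.
apply/seteqP; split => // z [n _]; have [_ _] := PUV n; exact.
Qed.

(** * Compactly supported bump functions *)

Section compactly_supported.
Context {R : realType} {E : ptopologicalType}.
Hypotheses (hE_loc : locally_compact [set: E]) (hE_haus : hausdorff_space E)
  (hE_count : @second_countable E).

Definition compact_bump (G : set E) (f : E -> R) := [/\ continuous f,
  forall x, 0 <= f x <= 1,
  forall x, ~ G x -> f x = 0 &
  exists2 K, compact K & forall x, ~ K x -> f x = 0].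

Lemma compact_bump_C0 G f : compact_bump G f -> C0 f.
Proof.
move=> [cf _ _ [K cK fK]]; split => // e e0; exists K => // x /fK ->.
by rewrite normr0.
Qed.

(** Complete regularity separates [x] from the complement of an open set that lies both in [G] and
    in a compact neighbourhood [U] of [x]. The separating function is 0 at [x] and 1 off that set,
    so the bump is its complement to 1. *)
Lemma compact_bump_pt G x : open G -> G x ->
  exists2 f, compact_bump G f & 0 < f x.
Proof.
move=> oG Gx.
have [U] := hE_loc x I; rewrite withinET => Ux [cU clU].
have oV : open (U° `&` G) by apply: openI => //; exact: open_interior.
have Vx : (U° `&` G) x by split => //; exact: nbhs_interior.
have := @locally_compact_completely_regular E R hE_loc hE_haus x _
  (open_closedC oV) (fun h => h Vx).
move=> /(@uniform_separatorP _ R)[f [cf f01 fx fV]].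
have fr y : 0 <= f y <= 1 by have := f01 (f y); rewrite /= in_itv/=; apply; exists y.
have f0 y : ~ (U° `&` G) y -> 1 - f y = 0.
  by move=> nV; rewrite (fV (f y)) ?subrr//; exists y.
exists (fun y => 1 - f y).
  split.
  - by move=> y; apply: cvgB; [exact: cvg_cst|exact: cf].
  - by move=> y; have := fr y; lra.
  - by move=> y nG; apply: f0 => -[].
  - by exists U => // y nU; apply: f0 => -[/interior_subset].
by rewrite (fx (f x)) ?subr0//; exists x.
Qed.

(** Countably many bumps [f i] are chosen whose positivity sets cover [G]. Truncating [n] times the
    sum of the first [n] of them at 1 keeps the support compact; at a point of [G] the value is 1 as
    soon as [n] exceeds some [i] with [f i x > 0] and [n * f i x >= 1]. *)
Lemma open_bump_approx (G : set E) : open G -> exists g : nat -> E -> R,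
  (forall n, compact_bump G (g n)) /\
  forall x, g n x @[n --> \oo] --> (\1_G x : R).
Proof.
move=> oG.
have [] := @lindelof_choice E (E -> R) (cst 0) (compact_bump G)
  (fun f => [set x | 0 < f x]) G hE_count.
- split => //.
  + by move=> y; exact: cvg_cst.
  + by move=> y; rewrite /= lexx ler01.
  + by exists set0 => //; exact: compact0.
- move=> x Gx; have [f fG fx] := compact_bump_pt _ _ oG Gx; exists f => //.
  have [cf _ _ _] := fG.
  have h : nbhs (f x) [set y | 0 < y] by exact: lt_nbhsr.
  exact: cf h.
move=> f [fG Gf].
have f0 i x : 0 <= f i x by have [_ /(_ x)/andP[]] := fG i.
pose g n x := Num.min 1 (n%:R * \sum_(i < n) f i x).
exists g; split.
  move=> n; split.
  - move=> x; apply: (@continuous_min R E (cst 1) (fun x => n%:R * \sum_(i < n) f i x)).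
      exact: cvg_cst.
    apply: cvgM; first exact: cvg_cst.
    apply: cvg_big => [|i _]; first exact: add_continuous.
    by have [cf _ _ _] := fG i; exact: cf.
  - move=> x; rewrite /g ge_min lexx/= le_min ler01/= andbT.
    by rewrite mulr_ge0// sumr_ge0.
  - move=> x nG; rewrite /g big1 ?mulr0 ?min_r// => i _.
    by have [_ _ /(_ x nG)] := fG i.
  - have /choice[K KP] i : exists K, compact K /\ forall x, ~ K x -> f i x = 0.
      by have [_ _ _ [K cK fK]] := fG i; exists K.
    exists (\big[setU/set0]_(i < n) K i).
      by apply: bigsetU_compact => i _; have [] := KP i.
    move=> x; rewrite -bigcup_mkord => nK.
    rewrite /g big1 ?mulr0 ?min_r// => i _.
    by apply: (KP i).2 => Kx; apply: nK; exists i => //=.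
move=> x; rewrite indicE; have [/set_mem Gx|/negP xG] := boolP (x \in G); last first.
  have nG : ~ G x by move=> Gx; apply: xG; exact/mem_set.
  rewrite (_ : (fun n => g n x) = cst 0); first exact: cvg_cst.
  apply/funext => n; rewrite /g big1 ?mulr0 ?min_r// => i _.
  by have [_ _ /(_ x nG)] := fG i.
have [i _ /= fi] := Gf _ Gx.
apply: cvg_near_cst.
near=> n; apply/eqP; rewrite /g /= eq_minl.
have lein : (i < n)%N by near: n; exists i.+1.
apply: (@le_trans _ _ (n%:R * f i x)).
  rewrite -ler_pdivrMr// mul1r.
  by near: n; exact: nbhs_infty_ger.
rewrite ler_wpM2l// (bigD1 (Ordinal lein))//= lerDl sumr_ge0//.
Unshelve. all: by end_near. Qed.

End compactly_supported.

(** * Integrals of [0, 1]-valued functions *)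

Section unit_valued_integrals.
Context {R : realType} {d} {T : measurableType d}.
Variable mu : {measure set T -> \bar R}.
Hypothesis mu1 : mu [set: T] = 1%E.
Implicit Types f g : T -> R.

Lemma measurable_fun_gt f : (forall a : R, measurable [set x | a < f x]) ->
  measurable_fun setT f.
Proof.
move=> mf; apply: (measurability _ (RGenOInfty.measurableE R)).
move=> /= _ [_ [a ->]] <-; rewrite setTI preimage_itvoy; exact: mf.
Qed.

Lemma integrable01 f : measurable_fun setT f -> (forall x, 0 <= f x <= 1) ->
  mu.-integrable setT (EFin \o f).
Proof.
move=> mf f01; apply: measurable_bounded_integrable => //.
  by rewrite mu1 ltry.
exists 1; split; first exact: num_real.
move=> M M1 x _ /=; have /andP[f0 f1] := f01 x.
by rewrite ger0_norm// (le_trans f1)// ltW.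
Qed.

Lemma le_Rintegral01 f g : measurable_fun setT f -> (forall x, 0 <= f x <= 1) ->
  measurable_fun setT g -> (forall x, 0 <= g x <= 1) ->
  (forall x, f x <= g x) -> \int[mu]_x f x <= \int[mu]_x g x.
Proof.
move=> mf f01 mg g01 fg; apply: le_Rintegral => //; exact: integrable01.
Qed.

Lemma Rintegral_cst1 (r : R) : \int[mu]_x r = r.
Proof.
rewrite (_ : (fun=> r) = cst r)// Rintegral_cst//.
by rewrite [X in fine X]mu1 /= mulr1.
Qed.

Lemma Rintegral01 f : measurable_fun setT f -> (forall x, 0 <= f x <= 1) ->
  0 <= \int[mu]_x f x <= 1.
Proof.
move=> mf f01; rewrite Rintegral_ge0/=; last by move=> x _; case/andP: (f01 x).
rewrite -[leRHS](Rintegral_cst1 1); apply: le_Rintegral01 => //.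
- by move=> x; rewrite ler01 lexx.
- by move=> x; case/andP: (f01 x).
Qed.

Lemma measure_le1 (A : set T) : measurable A -> (mu A <= 1)%E.
Proof. by move=> mA; rewrite -mu1 le_measure ?inE. Qed.

Lemma measure_fin (A : set T) : measurable A -> mu A \is a fin_num.
Proof.
by move=> mA; rewrite ge0_fin_numE// (le_lt_trans (measure_le1 _ mA))// ltry.
Qed.

Lemma Rintegral_indic01 (A : set T) : measurable A ->
  \int[mu]_x \1_A x = fine (mu A).
Proof. by move=> mA; rewrite /Rintegral integral_indic// setIT. Qed.

Lemma Rintegral01_cvg (g_ : nat -> T -> R) g :
  (forall n, measurable_fun setT (g_ n)) ->
  (forall n x, 0 <= g_ n x <= 1) ->
  measurable_fun setT g -> (forall x, 0 <= g x <= 1) ->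
  (forall x, g_ n x @[n --> \oo] --> g x) ->
  \int[mu]_x g_ n x @[n --> \oo] --> \int[mu]_x g x.
Proof.
move=> mg_ g_01 mg g01 gg.
apply: fine_cvg; rewrite fineK; last first.
  by apply: integrable_fin_num => //; exact: integrable01.
apply: (@dominated_cvg _ _ _ mu setT _ _ _ (cst 1%E)) => //.
- by move=> n; apply/measurable_EFinP; exact: mg_.
- by move=> x _; apply: cvg_EFin; [exact: nearW|exact: gg].
- rewrite (_ : cst 1%E = EFin \o cst 1)//; apply: integrable01 => //.
  by move=> x; rewrite /= ler01 lexx.
- move=> n x _; have /andP[g0 g1] := g_01 n x.
  by rewrite /= lee_fin ger0_norm.
Qed.

Lemma Rintegral_sum_indic (G : (set T)^nat) n : (forall j, measurable (G j)) ->
  mu.-integrable setT (EFin \o (fun x => \sum_(j < n) (\1_(G j) x : R))) /\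
  \int[mu]_x (\sum_(j < n) \1_(G j) x) = \sum_(j < n) fine (mu (G j)).
Proof.
move=> mG; elim: n => [|n [ih1 ih2]].
  split.
    rewrite (_ : _ \o _ = cst 0%E); first exact: integrable0.
    by apply/funext => x /=; rewrite big_ord0.
  under eq_Rintegral do rewrite big_ord0.
  by rewrite Rintegral_cst1 big_ord0.
have iG : mu.-integrable setT (EFin \o \1_(G n)).
  by apply: integrable01 => // x; rewrite indicE; case: (_ \in _); rewrite /= ?ler01 lexx.
split.
  rewrite (_ : _ \o _ = (EFin \o (fun x => (\sum_(j < n) (\1_(G j) x : R))%R)) \+
     (EFin \o \1_(G n)))%E; first exact: integrableD.
  by apply/funext => x /=; rewrite big_ord_recr.
under eq_Rintegral do rewrite big_ord_recr/=.
by rewrite RintegralD// ih2 big_ord_recr/= Rintegral_indic01.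
Qed.

End unit_valued_integrals.

(* The last two clauses are the induction invariant; the sum counts the positive
   integers below [y], so it lies within 1 of [y] as soon as [y <= n.+1]. *)
Lemma staircase_bounds {R : realType} (y : R) (n : nat) : 0 <= y ->
  let S := \sum_(j < n) ((j.+1%:R < y)%R%:R : R) in
  [/\ S <= y, S <= n%:R & y <= n.+1%:R -> y <= S + 1] /\
  (n.+1%:R < y -> S = n%:R).
Proof.
move=> y0; elim: n => [|n [[ih1 ih2 ih3] ih4]] /=.
  by rewrite big_ord0 add0r; split => //; split.
rewrite big_ord_recr/= -![n.+2%:R]natr1 -![n.+1%:R]natr1.
move: ih1 ih2 ih3 ih4; rewrite -![n.+1%:R]natr1.
set S := \sum_(_ < _) _ => ih1 ih2 ih3 ih4.
have [h|h] := ltP (n%:R + 1) y.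
  have {ih3 ih4}Sn := ih4 h.
  by rewrite /= Sn; split; [split|]; lra.
have {}ih3 := ih3 h.
by rewrite /= addr0; split; [split|]; lra.
Qed.

(** Layer-cake approximation: at [x], the sum of the indicators counts the levels below
    [N.+1 * m x], hence is within 1 of it. The integral is thus controlled, uniformly in [mu], by
    the measures of finitely many superlevel sets, which are open for a lower semicontinuous [m]. *)
Lemma Rintegral_staircase {R : realType} {d} {T : measurableType d}
    (mu : {measure set T -> \bar R}) (m : T -> R) (N : nat) :
  mu [set: T] = 1%E -> (forall a : R, measurable [set x | a < m x]) ->
  (forall x, 0 <= m x <= 1) ->
  0 <= \int[mu]_x m x - N.+1%:R^-1 *
    \sum_(j < N.+1) fine (mu [set x | j.+1%:R / N.+1%:R < m x]) <= N.+1%:R^-1.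
Proof.
move=> mu1 mm m01; set S := N.+1%:R^-1 * _.
rewrite subr_ge0 lerBlDl.
have N0 : 0 < N.+1%:R :> R by [].
pose G j := [set x | j.+1%:R / N.+1%:R < m x].
have mG j : measurable (G j) by exact: mm.
have [iG IG] := Rintegral_sum_indic _ mu1 _ N.+1 mG.
have im := integrable01 _ mu1 _ (measurable_fun_gt _ mm) m01.
have SE x : \sum_(j < N.+1) (\1_(G j) x : R) =
    \sum_(j < N.+1) (j.+1%:R < N.+1%:R * m x)%R%:R.
  apply: eq_bigr => j _; rewrite indicE; congr ((nat_of_bool _)%:R).
  rewrite mulrC -ltr_pdivrMr//; apply/idP/idP => [/set_mem//|h]; exact/mem_set.
have SB x : \sum_(j < N.+1) (\1_(G j) x : R) <= N.+1%:R * m x <=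
    \sum_(j < N.+1) (\1_(G j) x : R) + 1.
  have /andP[m0 m1] := m01 x; rewrite SE.
  have [|[-> _ h] _] := staircase_bounds (N.+1%:R * m x) N.+1.
    by rewrite mulr_ge0.
  apply: h; apply: (@le_trans _ _ N.+1%:R); last by rewrite ler_nat.
  by rewrite -[leRHS]mulr1 ler_wpM2l.
have -> : \int[mu]_x m x = N.+1%:R^-1 * \int[mu]_x (N.+1%:R * m x).
  by rewrite RintegralZl// mulKf// gt_eqF.
have iNm : mu.-integrable setT (EFin \o (fun x => N.+1%:R * m x)).
  exact: (integrableZl measurableT N.+1%:R im).
have i1 : mu.-integrable setT (EFin \o cst 1).
  by apply: integrable01 => // x; rewrite /= ler01 lexx.
apply/andP; split.
  rewrite /S ler_pM2l ?invr_gt0// -IG; apply: le_Rintegral => // x _.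
  by case/andP: (SB x).
rewrite /S -[X in _ + X]mulr1 -mulrDr ler_pM2l ?invr_gt0//.
rewrite -IG -[X in _ + X](Rintegral_cst1 _ mu1) -RintegralD//.
apply: le_Rintegral => //.
  exact: (integrableD measurableT iG i1).
by move=> x _; case/andP: (SB x).
Qed.

(** * Weak convergence and tightness *)

Section probability_of_measure.
Context {R : realType} {d} {T : measurableType d}.
Variables (mu : {measure set T -> \bar R}) (mu1 : mu [set: T] = 1%E).

Let P : set T -> \bar R := mu.

HB.instance Definition _ := Measure.on P.

HB.instance Definition _ := Measure_isProbability.Build _ _ _ P mu1.

Lemma probability_of_measure : exists Q : probability T R, forall A, Q A = mu A.
Proof. by exists P. Qed.

End probability_of_measure.

Lemma open_borel {E : ptopologicalType} (G : set E) : open G ->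
  measurable (G : set (borel E)).
Proof. by move=> oG; exact: sub_sigma_algebra. Qed.

Lemma compact_borel {E : ptopologicalType} (K : set E) : hausdorff_space E ->
  compact K -> measurable (K : set (borel E)).
Proof.
move=> hE cK; rewrite -[K]setCK; apply: measurableC; apply: open_borel.
by apply: closed_openC; exact: compact_closed.
Qed.

Lemma continuous_borel {R : realType} {E : ptopologicalType} (f : E -> R) :
  continuous f -> measurable_fun [set: borel E] f.
Proof.
move=> cf; apply: measurable_fun_gt => a; apply: open_borel.
rewrite (_ : [set x | a < f x] = f @^-1` [set y | a < y])//.
by apply: open_comp => //; exact: open_gt.
Qed.

Section weak_convergence.
Context {R : realType} {E : ptopologicalType}.
Hypotheses (hE_loc : locally_compact [set: E]) (hE_haus : hausdorff_space E)
  (hE_count : @second_countable E).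
Implicit Types mu nu : {measure set (borel E) -> \bar R}.

(** One sequence [g] serves all [mu] at once, so that different measures can be compared through the
    same test functions. *)
Lemma bump_measure_cvg (G : set E) : open G ->
  exists2 g : nat -> E -> R, (forall n, compact_bump G (g n)) &
  forall mu, mu setT = 1%E -> \int[mu]_x g n x @[n --> \oo] --> fine (mu G).
Proof.
move=> oG.
have [g [gG gcv]] := @open_bump_approx R E hE_loc hE_haus hE_count G oG.
exists g => // mu mu1.
rewrite -(Rintegral_indic01 mu _ (open_borel _ oG)).
apply: Rintegral01_cvg => //.
- by move=> n; have [cg _ _ _] := gG n; exact: continuous_borel.
- by move=> n x; have [_ g01 _ _] := gG n; exact: g01.
- by apply: measurable_indic; exact: open_borel.
- by move=> x; rewrite indicE; case: (_ \in _); rewrite /= ?ler01 lexx.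
Qed.

(** Bumps lie in [C0] and recover the measure of every open set; open sets form a generating
    pi-system. *)
Lemma C0_measure_unique mu nu : mu setT = 1%E -> nu setT = 1%E ->
  (forall f, C0 f -> (forall x, 0 <= f x <= 1) ->
    \int[mu]_x f x = \int[nu]_x f x) ->
  forall A, measurable A -> mu A = nu A.
Proof.
move=> mu1 nu1 munu A mA.
apply: (@measure_unique _ R (borel E) open (fun=> setT)) => //.
- by move=> B C oB oC; exact: openI.
- by move=> _; exact: openT.
- by rewrite bigcup_const//; exists 0%N.
- move=> G oG.
  have mG := open_borel _ oG.
  have [g gG gmu] := bump_measure_cvg G oG.
  rewrite -(fineK (measure_fin _ mu1 _ mG)) -(fineK (measure_fin _ nu1 _ mG)).
  congr (_%:E); apply: (cvg_unique _ (gmu mu mu1)) => //.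
  rewrite (_ : (fun n => _) = (fun n => \int[nu]_x g n x)); first exact: gmu.
  by apply/funext => n; apply: munu; [exact: (compact_bump_C0 _ _ (gG n))|case: (gG n)].
- by move=> _; rewrite mu1 ltry.
Qed.

(** Some bump has integral above [1 - e] against [mu], hence eventually against [mu_ n], and it is
    dominated by the indicator of a compact set carrying it. *)
Lemma weak_cvg_tight (mu_ : nat -> {measure set (borel E) -> \bar R}) mu :
  (forall n, mu_ n setT = 1%E) -> mu setT = 1%E -> weak_cvg mu_ mu ->
  forall e : R, 0 < e -> exists2 K : set E, compact K &
    \forall n \near \oo, 1 - e < fine (mu_ n K).
Proof.
move=> mun1 mu1 wmu e e0.
have [g gT /(_ mu mu1)] := bump_measure_cvg setT openT.
rewrite mu1 /= => gmu.
have [n gn] : exists n, 1 - e < \int[mu]_x g n x.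
  have : \forall n \near \oo, 1 - e < \int[mu]_x g n x.
    by apply: (cvgr_gt _ gmu); lra.
  by case=> n _ /(_ n (leqnn n)); exists n.
have [cg g01 _ [K cK gK]] := gT n.
have mK := compact_borel _ hE_haus cK.
exists K => //.
have : \int[mu_ k]_x g n x @[k --> \oo] --> \int[mu]_x g n x.
  apply: wmu => //; exists 1 => x; have /andP[g0 g1] := g01 x.
  by rewrite ger0_norm.
move=> /cvgr_gt/(_ _ gn); apply: filterS => k /lt_le_trans; apply.
rewrite -Rintegral_indic01//; apply: le_Rintegral01 => //.
- exact: continuous_borel.
- by move=> x; rewrite indicE; case: (_ \in _); rewrite /= ?ler01 lexx.
- move=> x; rewrite indicE; have [//|/negP xK] := boolP (x \in K).
    by case/andP: (g01 x).
  by rewrite gK// => Kx; apply: xK; exact/mem_set.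
Qed.

End weak_convergence.

(** * Limits of tight sequences along an ultrafilter *)

(** Compactness of the unit interval gives a cluster point, and an ultrafilter converges to each of
    its cluster points. *)
Lemma ultra_unit_cvg {R : realType} (U : set_system nat) (u : nat -> R) :
  UltraFilter U -> (forall k, 0 <= u k <= 1) -> exists l : R, u @ U --> l.
Proof.
move=> UU u01.
have [|l [_ lcl]] := @segment_compact R 0 1 (u @ U) _.
  by apply: nearW => k; rewrite /= in_itv/= u01.
exists l => V Vl.
have [//|nV] := in_ultra_setVsetC (u @^-1` V) UU.
by have [x [? ?]] := lcl (~` V) V nV Vl.
Qed.

(** On an open [G], [gamma] is the supremum of [lam] over compact subsets, whence the inequality. It
    can be strict: [lam G] also counts mass that escapes to the boundary of [G]. *)
Lemma tight_ultra_limit {R : realType} {Z : ptopologicalType}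
    (gamma_ : nat -> probability (borel Z) R) : hausdorff_space Z ->
  (forall e : R, 0 < e -> exists2 K : set Z, compact K &
    \forall n \near \oo, 1 - e < fine (gamma_ n K)) ->
  exists (U : set_system nat) (gamma : probability (borel Z) R) (lam : set Z -> R),
  [/\ ProperFilter U, \oo `<=` U,
      forall A : set (borel Z), measurable A -> fine (gamma_ n A) @[n --> U] --> lam A &
      forall G, open G -> fine (gamma G) <= lam G].
Proof.
move=> hZ tight.
have [U [UU ooU]] := ultraFilterLemma eventually_filter.
have mc (K : set Z) : compact K -> measurable (K : set (borel Z)).
  exact: compact_borel.
have g1 n : gamma_ n [set: borel Z] = 1%E by exact: probability_setT.
have gfin n (A : set (borel Z)) : measurable A -> gamma_ n A \is a fin_num.
  exact: fin_num_measure.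
have g01 n (A : set (borel Z)) : measurable A -> 0 <= fine (gamma_ n A) <= 1.
  move=> mA; rewrite fine_ge0//= -lee_fin fineK ?gfin//; exact: probability_le1.
(* On non-measurable sets [lam] takes an arbitrary value; compact sets are Borel because [Z] is
   Hausdorff. *)
have /choice[lam lamP] (A : set Z) : exists l : R, measurable (A : set (borel Z)) ->
    fine (gamma_ n A) @[n --> U] --> l.
  have [mA|nmA] := pselect (measurable (A : set (borel Z))); last by exists 0.
  have [l hl] := @ultra_unit_cvg _ U (fun n => fine (gamma_ n A)) UU (fun n => g01 n _ mA).
  by exists l.
have PU : ProperFilter U by exact: ultra_proper.
have lam_ge A b : measurable (A : set (borel Z)) ->
    (\forall n \near U, b <= fine (gamma_ n A)) -> b <= lam A.
  by move=> mA; exact: cvgr_to_ge (lamP _ mA).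
have lam_le A b : measurable (A : set (borel Z)) ->
    (\forall n \near U, fine (gamma_ n A) <= b) -> lam A <= b.
  by move=> mA; exact: cvgr_to_le (lamP _ mA).
have lam_sub A B : measurable (A : set (borel Z)) -> measurable (B : set (borel Z)) ->
    A `<=` B -> lam A <= lam B.
  move=> mA mB AB; apply: ler_cvg_to (lamP _ mA) (lamP _ mB) _.
  apply: nearW => n; rewrite fine_le ?gfin//.
  by apply: le_measure => //; rewrite inE.
have lamU A B : measurable (A : set (borel Z)) -> measurable (B : set (borel Z)) ->
    lam (A `|` B) <= lam A + lam B.
  move=> mA mB; have mAB : measurable (A `|` B : set (borel Z)) by exact: measurableU.
  apply: ler_cvg_to (lamP _ mAB) (cvgD (lamP _ mA) (lamP _ mB)) _.
  apply: nearW => n; rewrite fctE -fineD ?gfin// fine_le ?gfin ?fin_numD ?gfin//.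
  exact: measureU2.
have lamD A B : measurable (A : set (borel Z)) -> measurable (B : set (borel Z)) ->
    A `&` B = set0 -> lam A + lam B <= lam (A `|` B).
  move=> mA mB AB0; have mAB : measurable (A `|` B : set (borel Z)) by exact: measurableU.
  apply: ler_cvg_to (cvgD (lamP _ mA) (lamP _ mB)) (lamP _ mAB) _.
  by apply: nearW => n; rewrite fctE -fineD ?gfin// measureU.
have c0 K : compact K -> 0 <= lam K.
  by move=> /mc mK; apply: lam_ge => //; apply: nearW => n; case/andP: (g01 n _ mK).
have c1 K : compact K -> lam K <= 1.
  by move=> /mc mK; apply: lam_le => //; apply: nearW => n; case/andP: (g01 n _ mK).
have cU K L : compact K -> compact L -> lam (K `|` L) <= lam K + lam L.
  by move=> /mc mK /mc mL; exact: lamU.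
have cD K L : compact K -> compact L -> K `&` L = set0 ->
    lam K + lam L <= lam (K `|` L).
  by move=> /mc mK /mc mL; exact: lamD.
have [mu muE] := content_measure_ex hZ _ c0 c1 cU cD.
(* Tightness enters here: the compact [K] for [e] satisfies [1 - e <= lam K], so no mass is lost in
   the limit. *)
have mu1 : mu setT = 1%E.
  rewrite muE; last exact: openT.
  apply/eqP; rewrite eq_le content_inner_le1//=.
  apply/lee_addgt0Pr => e e0; have [K cK hK] := tight _ e0.
  apply: (@le_trans _ _ ((lam K)%:E + e%:E)%E); last first.
    by rewrite leeD2r// content_inner_ge.
  rewrite -EFinD lee_fin -lerBlDr; apply: lam_ge; first exact: mc.
  by apply: ooU; apply: filterS hK => n /ltW.
have [gamma gammaE] := probability_of_measure _ mu1.
exists U, gamma, lam; split => // G oG.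
rewrite gammaE -lee_fin fineK; last by apply: (measure_fin _ mu1); exact: open_borel.
rewrite muE//; apply: ge_ereal_sup => _ [K [cK KG] <-].
by rewrite lee_fin; apply: lam_sub => //; [exact: mc|exact: open_borel].
Qed.

(** The staircase sums involve only open superlevel sets: under [gamma_ n] they lie below the
    integral and converge to the sum for [lam], which dominates the sum for [gamma]. The error
    [N.+1%:R^-1] then tends to 0. *)
Lemma lsc_Rintegral_le_ultra {R : realType} {Z : ptopologicalType}
    (gamma_ : nat -> probability (borel Z) R) (gamma : probability (borel Z) R)
    (U : set_system nat) (lam : set Z -> R) : ProperFilter U ->
  (forall A : set (borel Z), measurable A -> fine (gamma_ n A) @[n --> U] --> lam A) ->
  (forall G, open G -> fine (gamma G) <= lam G) ->
  forall (m : Z -> R) (b : R), (forall a, open [set z | a < m z]) ->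
    (forall z, 0 <= m z <= 1) ->
    (\forall n \near U, \int[gamma_ n]_z m z <= b) -> \int[gamma]_z m z <= b.
Proof.
move=> PU lamP gammaP m b om m01 mb.
have mm a : measurable ([set z | a < m z] : set (borel Z)) by exact: open_borel.
have sg (P : probability (borel Z) R) N :=
  @Rintegral_staircase R _ (borel Z) P m N (probability_setT P) mm m01.
pose G N j := [set z | j.+1%:R / N.+1%:R < m z].
have key N : \int[gamma]_z m z <= b + N.+1%:R^-1.
  have cvN : N.+1%:R^-1 * \sum_(j < N.+1) fine (gamma_ n (G N j)) @[n --> U] -->
      N.+1%:R^-1 * \sum_(j < N.+1) lam (G N j).
    apply: cvgM; first exact: cvg_cst.
    by apply: cvg_big => [|j _]; [exact: add_continuous|apply: lamP; exact: mm].
  have le1 : N.+1%:R^-1 * \sum_(j < N.+1) lam (G N j) <= b.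
    apply: cvgr_to_le cvN _; apply: filterS mb => n; apply: le_trans.
    by have /andP[+ _] := sg (gamma_ n) N; rewrite subr_ge0.
  have /andP[_] := sg gamma N; rewrite lerBlDl => /le_trans; apply.
  rewrite lerD2r; apply: le_trans le1.
  by rewrite ler_pM2l ?invr_gt0//; apply: ler_sum => j _; exact: gammaP.
apply/ler_addgt0Pr => e e0.
have [N _ hN] := near_infty_natSinv_lt (PosNum e0).
apply: (le_trans (key N)); rewrite lerD2l ltW//.
exact: (hN N (leqnn N)).
Qed.

(** * Limits of couplings *)

(* Products carry both a pointed and a topological structure, but the join of
   the two is not declared. *)
Canonical prod_ptopologicalType (E F : ptopologicalType) : ptopologicalType :=
  HB.pack (E * F)%type (Topological.class (E * F)%type) (Pointed.class (E * F)%type).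

Lemma probability_pushforward {R : realType} {d d'} {T : measurableType d}
    {T' : measurableType d'} (P : probability T R) (phi : T -> T') :
  measurable_fun setT phi ->
  exists Q : probability T' R, forall A, Q A = P (phi @^-1` A).
Proof.
move=> mphi; pose f : {mfun T >-> T'} :=
  HB.pack phi (isMeasurableFun.Build _ _ _ _ phi mphi).
by exists (distribution P f).
Qed.

Lemma Rintegral_marginal {R : realType} {d d'} {T : measurableType d}
    {T' : measurableType d'} (P : {measure set T -> \bar R})
    (mu : {measure set T' -> \bar R}) (phi : T -> T') (f : T' -> R) :
  measurable_fun setT phi ->
  (forall A, measurable A -> P (phi @^-1` A) = mu A) ->
  measurable_fun setT f -> (forall x, 0 <= f x) ->
  \int[P]_z f (phi z) = \int[mu]_x f x.
Proof.
move=> mphi Pmu mf f0; congr fine.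
have := @ge0_integral_pushforward _ _ _ _ _ phi mphi P setT (EFin \o f) measurableT.
rewrite preimage_setT => <- //; last 2 first.
- exact/measurable_EFinP.
- by move=> y _; rewrite /= lee_fin.
apply: eq_measure_integral => A mA _; exact: Pmu.
Qed.

Section coupling_limits.
Context {R : realType} {E : ptopologicalType}.
Hypotheses (hE_loc : locally_compact [set: E]) (hE_haus : hausdorff_space E)
  (hE_count : @second_countable E).
Implicit Types mu nu : {measure set (borel E) -> \bar R}.
Let Z : ptopologicalType := (E * E)%type.

(** Couplings live on the product sigma-algebra, ultrafilter limits on the Borel sets of the
    product. This map and [borel_prod_id] transport probabilities between the two; this direction
    rests on second countability, the other on continuity of the projections. *)
Lemma prod_borel_id : measurable_fun setT (id : borel E * borel E -> borel Z).
Proof.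
apply: (@measurability _ _ (borel E * borel E)%type (borel Z) _ _ (@open Z)) => //.
move=> _ [G oG <-]; rewrite setTI preimage_id.
exact: (open_measurable_prod hE_count hE_count).
Qed.

Lemma borel_prod_id : measurable_fun setT (id : borel Z -> borel E * borel E).
Proof.
have mC (p : Z -> E) : continuous p -> measurable_fun setT (p : borel Z -> borel E).
  move=> cp; apply: (@measurability _ _ (borel Z) (borel E) _ _ (@open E)) => //.
  move=> _ [G oG <-]; rewrite setTI; apply: open_borel.
  by apply: open_comp.
have -> : (id : borel Z -> borel E * borel E) = (fun z => (z.1, z.2)).
  by apply/funext => -[].
apply: measurable_fun_pair; apply: mC.
- by move=> x; exact: cvg_fst.
- by move=> x; exact: cvg_snd.
Qed.

Lemma prod_hausdorff : hausdorff_space Z.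
Proof.
move=> [x1 x2] [y1 y2] xy; congr pair; apply: hE_haus => A B nA nB.
- have [||[a b] [[/= Aa _] [Ba _]]] := xy (A `*` setT) (B `*` setT); last by exists a.
  + by exists (A, setT) => //; split => //=; exact: filterT.
  + by exists (B, setT) => //; split => //=; exact: filterT.
- have [||[a b] [[/= _ Aa] [_ Ba]]] := xy (setT `*` A) (setT `*` B); last by exists b.
  + by exists (setT, A) => //; split => //=; exact: filterT.
  + by exists (setT, B) => //; split => //=; exact: filterT.
Qed.

(** The [gamma_ n] are moved to the Borel sets of the product, where tight marginals make them
    tight. The cost inequality [main] for the limit comes first; that the limit is a coupling is
    then deduced from it. *)
Lemma coupling_limit (mu_ nu_ : nat -> {measure set (borel E) -> \bar R}) mu nu
    (gamma_ : nat -> probability (borel E * borel E)%type R) :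
  (forall n, mu_ n setT = 1%E) -> mu setT = 1%E -> weak_cvg mu_ mu ->
  (forall n, nu_ n setT = 1%E) -> nu setT = 1%E -> weak_cvg nu_ nu ->
  (forall n, couplings (mu_ n) (nu_ n) (gamma_ n)) ->
  exists2 gamma, couplings mu nu gamma &
  forall (m : E -> E -> R) (b : R), (forall a, open [set z : Z | a < m z.1 z.2]) ->
    (forall x y, 0 <= m x y <= 1) ->
    (\forall n \near \oo, \int[gamma_ n]_z m z.1 z.2 <= b) ->
    \int[gamma]_z m z.1 z.2 <= b.
Proof.
move=> mun1 mu1 wmu nun1 nu1 wnu cgam.
have /choice[g gE] n : exists Q : probability (borel Z) R, forall A, Q A = gamma_ n A.
  by have [Q QE] := probability_pushforward (gamma_ n) _ prod_borel_id; exists Q.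
have tight (e : R) : 0 < e -> exists2 K : set Z, compact K &
    \forall n \near \oo, 1 - e < fine (g n K).
  (* Half of [e] for each marginal: the mass outside [K] times [L] is at most the sum of the
     marginal masses outside [K] and outside [L]. *)
  move=> e0; have e20 : 0 < e / 2 by rewrite divr_gt0.
  have [K cK hK] := weak_cvg_tight hE_loc hE_haus hE_count _ _ mun1 mu1 wmu _ e20.
  have [L cL hL] := weak_cvg_tight hE_loc hE_haus hE_count _ _ nun1 nu1 wnu _ e20.
  exists (K `*` L); first exact: compact_setX.
  near=> n; rewrite gE.
  have mK := compact_borel _ hE_haus cK; have mL := compact_borel _ hE_haus cL.
  have [gK _] := cgam n _ mK; have [_ gL] := cgam n _ mL.
  have hK' : 1 - e / 2 < fine (mu_ n K) by near: n.
  have hL' : 1 - e / 2 < fine (nu_ n L) by near: n.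
  pose A := fst @^-1` K : set (borel E * borel E)%type.
  pose B := snd @^-1` L : set (borel E * borel E)%type.
  have mA : measurable A by rewrite -[A]setTI; exact: measurable_fst.
  have mB : measurable B by rewrite -[B]setTI; exact: measurable_snd.
  have : (gamma_ n A <= gamma_ n (A `&` B) + gamma_ n (~` B))%E.
    apply: (@le_trans _ _ (gamma_ n ((A `&` B) `|` ~` B))).
      apply: le_measure; rewrite ?inE//.
        by apply: measurableU; [exact: measurableI|exact: measurableC].
      move=> z Az; have [Bz|nBz] := pselect (B z); [by left|by right].
    by apply: measureU2; [exact: measurableI|exact: measurableC].
  rewrite probability_setC// [X in (X <= _)%E]gK [X in (1 - X)%E]gL.
  rewrite -(fineK (measure_fin _ (mun1 n) _ mK)) -(fineK (measure_fin _ (nun1 n) _ mL)).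
  rewrite (_ : A `&` B = K `*` L)//.
  have fX : gamma_ n (K `*` L) \is a fin_num.
    by apply: fin_num_measure; exact: measurableX.
  rewrite -(fineK fX) -EFinB -EFinD lee_fin => h; lra.
have [U [g0 [lam [PU ooU lamP g0P]]]] := tight_ultra_limit g prod_hausdorff tight.
have [gamma gammaE] :
    exists Q : probability (borel E * borel E)%type R, forall A, Q A = g0 A.
  by have [Q QE] := probability_pushforward g0 _ borel_prod_id; exists Q.
have main (m : E -> E -> R) (b : R) : (forall a, open [set z : Z | a < m z.1 z.2]) ->
    (forall x y, 0 <= m x y <= 1) ->
    (\forall n \near \oo, \int[gamma_ n]_z m z.1 z.2 <= b) ->
    \int[gamma]_z m z.1 z.2 <= b.
  move=> om m01 mb; pose m' (z : Z) := m z.1 z.2.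
  have mm' : measurable_fun setT (m' : borel Z -> R).
    by apply: measurable_fun_gt => a; apply: open_borel; exact: om.
  have m'0 z : 0 <= m' z by case/andP: (m01 z.1 z.2).
  have gg (Q : probability (borel E * borel E)%type R) (P : probability (borel Z) R) :
      (forall A, P A = Q A) -> \int[Q]_z m z.1 z.2 = \int[P]_z m' z.
    move=> PQ; apply: (@Rintegral_marginal _ _ _ _ _ Q P id m') => //.
      exact: prod_borel_id.
    by move=> A _; rewrite preimage_id PQ.
  rewrite (gg _ g0)//; apply: (lsc_Rintegral_le_ultra g g0 U lam) => //.
    by move=> z; exact: m01.
  by apply: ooU; apply: filterS mb => n; rewrite (gg _ (g n)).
(* A continuous [f] composed with a projection [p] is itself an admissible cost, whose integral
   against [gamma_ n] is that of [f] against the marginal; so [main] applies to it. *)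
have marg (p : Z -> E) (rho_ : nat -> {measure set (borel E) -> \bar R})
    (rho : {measure set (borel E) -> \bar R}) :
    measurable_fun setT (p : borel E * borel E -> borel E) -> continuous p ->
    rho setT = 1%E -> (forall n, rho_ n setT = 1%E) -> weak_cvg rho_ rho ->
    (forall n (A : set (borel E)), measurable A -> gamma_ n (p @^-1` A) = rho_ n A) ->
    forall A : set (borel E), measurable A -> gamma (p @^-1` A) = rho A.
  move=> mp cp rho1 rhon1 wrho gp A mA.
  have [pi piE] := probability_pushforward gamma _ mp.
  rewrite -piE; apply: (C0_measure_unique hE_loc hE_haus hE_count) => //.
    exact: (probability_setT pi).
  (* Applied to [f] and to [1 - f], this gives equality. *)
  have le_f (f : E -> R) : continuous f -> (forall x, 0 <= f x <= 1) ->
      \int[pi]_x f x <= \int[rho]_x f x.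
    move=> cf f01; apply/ler_addgt0Pr => e e0.
    have mf := continuous_borel _ cf.
    have f0 x : 0 <= f x by case/andP: (f01 x).
    rewrite -(Rintegral_marginal gamma pi p f)//; last by move=> B _; rewrite piE.
    have pE (P : probability (borel E * borel E)%type R) :
        \int[P]_z f (p z) = \int[P]_z f (p (z.1, z.2)).
      by apply: eq_Rintegral => -[].
    rewrite pE; apply: (main (fun x y => f (p (x, y)))) => //.
      move=> a; rewrite (_ : [set z | _] = (f \o p) @^-1` [set y | a < y]); last first.
        by apply/seteqP; split=> -[].
      apply: open_comp; last exact: open_gt.
      by move=> z _; apply: continuous_comp; [exact: cp|exact: cf].
    have : \int[rho_ n]_x f x @[n --> \oo] --> \int[rho]_x f x.
      by apply: wrho => //; exists 1 => x; have /andP[_ f1] := f01 x; rewrite ger0_norm.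
    move=> /cvgr_lt/(_ (\int[rho]_x f x + e)); rewrite ltrDl => /(_ e0).
    apply: filterS => n /ltW; rewrite -pE (Rintegral_marginal (gamma_ n) (rho_ n) p f)//.
    exact: gp.
  move=> f [cf _] f01; apply/eqP; rewrite eq_le le_f//=.
  have mf := continuous_borel _ cf.
  have cf' : continuous (fun x => 1 - f x).
    by move=> x; apply: cvgB; [exact: cvg_cst|exact: cf].
  have ilin (P : {measure set (borel E) -> \bar R}) : P setT = 1%E ->
      \int[P]_x (1 - f x) = 1 - \int[P]_x f x.
    move=> P1; rewrite RintegralB//; last 2 first.
    - by apply: (integrable01 _ P1 (cst 1)) => // x; rewrite /= ler01 lexx.
    - exact: integrable01.
    by rewrite Rintegral_cst1.
  have := le_f _ cf'; rewrite (ilin _ (probability_setT pi)) (ilin _ rho1).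
  by rewrite lerD2l lerN2; apply => x; have := f01 x; lra.
exists gamma => // A mA; split.
- apply: (marg fst mu_ mu) => //.
  + by move=> x; exact: cvg_fst.
  + by move=> n B mB; have [] := cgam n B mB.
- apply: (marg snd nu_ nu) => //.
  + by move=> x; exact: cvg_snd.
  + by move=> n B mB; have [] := cgam n B mB.
Unshelve. all: by end_near. Qed.

End coupling_limits.

(** * The transport cost *)

(** If [G] were not a neighbourhood of [z], one could pick [u k] outside [G] but in each of the
    first [k] basic sets that contain [z]; such a sequence converges to [z]. *)
Lemma open_seq {Z : topologicalType} (G : set Z) : @second_countable Z ->
  (forall (u : nat -> Z) z, G z -> u @ \oo --> z -> exists n, G (u n)) -> open G.
Proof.
move=> /second_countable_seqP[B [oB xB]] Gseq; rewrite openE => z Gz.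
apply: contrapT => nG.
have /choice[u uP] k : exists x, ~ G x /\ forall i, (i < k)%N -> B i z -> B i x.
  apply: contrapT => nx; apply: nG.
  have : nbhs z [set x | forall i, (i < k)%N -> B i z -> B i x].
    elim: k {nx} => [|k ih]; first by apply: filterS filterT => x _ [].
    have [Bk|nBk] := pselect (B k z); last first.
      apply: filterS ih => x h i; rewrite ltnS leq_eqVlt => /predU1P[->//|].
      exact: h.
    have nBk : nbhs z (B k) by exact: open_nbhs_nbhs.
    apply: filterS2 ih nBk => x h Bkx i; rewrite ltnS leq_eqVlt => /predU1P[->//|].
    exact: h.
  by apply: filterS => x h; apply: contrapT => nGx; apply: nx; exists x.
have [|n] := Gseq u z Gz; last by have [] := uP n.
move=> V /xB[i Biz BiV]; exists i.+1 => // k /= ik.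
by apply: BiV; exact: (uP k).2.
Qed.

Section transport_cost.
Context {R : realType} {E : ptopologicalType}.
Hypotheses (hE_loc : locally_compact [set: E]) (hE_haus : hausdorff_space E)
  (hE_count : @second_countable E).
Implicit Types (mu nu : {measure set (borel E) -> \bar R}) (m : E -> E -> R).

Definition lsc01 m := (forall a, open [set z : E * E | a < m z.1 z.2]) /\
  forall x y, 0 <= m x y <= 1.

Lemma lsc01_measurable m : lsc01 m ->
  measurable_fun setT (fun z : borel E * borel E => m z.1 z.2).
Proof.
move=> [om _]; apply: measurable_fun_gt => a.
exact: (open_measurable_prod hE_count hE_count).
Qed.

(* Without a coupling [W] would be the junk value [inf set0 = 0]. *)
Lemma couplings_neq0 mu nu : mu setT = 1%E -> nu setT = 1%E ->
  couplings mu nu !=set0.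
Proof.
move=> mu1 nu1.
have [P PE] := probability_of_measure _ mu1.
have [Q QE] := probability_of_measure _ nu1.
exists (P \x Q)%E => A mA; split.
  rewrite (_ : fst @^-1` A = A `*` setT); last first.
    by apply/seteqP; split => -[x y] // [].
  by rewrite [LHS]product_measure1E// PE [X in (_ * X)%E]probability_setT mule1.
rewrite (_ : snd @^-1` A = setT `*` A); last first.
  by apply/seteqP; split => -[x y] // [].
rewrite [LHS]product_measure1E// [X in (X * _)%E](probability_setT P).
by rewrite [LHS]mul1e; exact: QE.
Qed.

Lemma W_has_inf m mu nu : mu setT = 1%E -> nu setT = 1%E -> lsc01 m ->
  has_inf [set \int[gamma]_z m z.1 z.2 | gamma in couplings mu nu].
Proof.
move=> mu1 nu1 [_ m01]; split.
  by have [g cg] := couplings_neq0 _ _ mu1 nu1; eexists; exists g.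
exists 0 => _ [g _ <-]; apply: Rintegral_ge0 => z _.
by case/andP: (m01 z.1 z.2).
Qed.

Lemma W_le m mu nu gamma : mu setT = 1%E -> nu setT = 1%E -> lsc01 m ->
  couplings mu nu gamma -> W m mu nu <= \int[gamma]_z m z.1 z.2.
Proof.
move=> mu1 nu1 lm cg; apply: ge_inf; last by exists gamma.
by have [] := W_has_inf _ _ _ mu1 nu1 lm.
Qed.

Lemma W_ge m mu nu (a : R) : mu setT = 1%E -> nu setT = 1%E ->
  (forall gamma, couplings mu nu gamma -> a <= \int[gamma]_z m z.1 z.2) ->
  a <= W m mu nu.
Proof.
move=> mu1 nu1 am; apply: lb_le_inf; last by move=> _ [g cg <-]; exact: am.
by have [g cg] := couplings_neq0 _ _ mu1 nu1; eexists; exists g.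
Qed.

Lemma W_adherent m mu nu (e : R) : mu setT = 1%E -> nu setT = 1%E -> lsc01 m ->
  0 < e -> exists2 gamma, couplings mu nu gamma &
    \int[gamma]_z m z.1 z.2 < W m mu nu + e.
Proof.
move=> mu1 nu1 lm e0.
have [_ [g cg <-] h] := inf_adherent e0 (W_has_inf _ _ _ mu1 nu1 lm).
by exists g.
Qed.

Lemma W01 m mu nu : mu setT = 1%E -> nu setT = 1%E -> lsc01 m ->
  0 <= W m mu nu <= 1.
Proof.
move=> mu1 nu1 lm; have [_ m01] := lm; apply/andP; split.
  apply: W_ge => // g _; apply: Rintegral_ge0 => z _.
  by case/andP: (m01 z.1 z.2).
have [g cg] := couplings_neq0 _ _ mu1 nu1.
apply: (le_trans (W_le _ _ _ _ mu1 nu1 lm cg)).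
have /andP[//] := Rintegral01 g (probability_setT g) _ (lsc01_measurable _ lm)
  (fun z => m01 z.1 z.2).
Qed.

Lemma le_W m1 m2 mu nu : mu setT = 1%E -> nu setT = 1%E ->
  lsc01 m1 -> lsc01 m2 -> (forall x y, m1 x y <= m2 x y) ->
  W m1 mu nu <= W m2 mu nu.
Proof.
move=> mu1 nu1 lm1 lm2 m12; apply: W_ge => // g cg.
apply: (le_trans (W_le _ _ _ _ mu1 nu1 lm1 cg)).
apply: (le_Rintegral01 g (probability_setT g)) => //.
- exact: lsc01_measurable.
- by move=> z; exact: lm1.2.
- exact: lsc01_measurable.
- by move=> z; exact: lm2.2.
Qed.

(** Let [g k] be nearly optimal for [m_ k], and [gamma] a limit of these couplings with fixed
    marginals. For fixed [n] and [k >= n], monotonicity bounds the integral of [m_ n] against [g k]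
    by [a + k.+1%:R^-1], hence against [gamma] by [a]; dominated convergence in [n] concludes. *)
Lemma W_cvg_le (m_ : nat -> E -> E -> R) m mu nu (a : R) :
  mu setT = 1%E -> nu setT = 1%E -> (forall n, lsc01 (m_ n)) -> lsc01 m ->
  (forall x y, {homo (fun n => m_ n x y) : n k / (n <= k)%N >-> n <= k}) ->
  (forall x y, m_ n x y @[n --> \oo] --> m x y) ->
  (forall n, W (m_ n) mu nu <= a) -> W m mu nu <= a.
Proof.
move=> mu1 nu1 lm_ lm m_nd m_m Wa.
have /choice[g gP] n : exists g, couplings mu nu g /\
    \int[g]_z m_ n z.1 z.2 < a + n.+1%:R^-1.
  have [|g cg hg] := W_adherent (m_ n) mu nu n.+1%:R^-1 mu1 nu1 (lm_ n).
    by rewrite invr_gt0.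
  by exists g; split => //; apply: (lt_le_trans hg); rewrite lerD2r.
have wcst (rho : {measure set (borel E) -> \bar R}) : weak_cvg (fun=> rho) rho.
  by move=> f _ _; exact: cvg_cst.
have [gamma cgamma gammaP] := coupling_limit hE_loc hE_haus hE_count
  (fun=> mu) (fun=> nu) mu nu g (fun=> mu1) mu1 (wcst mu) (fun=> nu1) nu1 (wcst nu)
  (fun n => (gP n).1).
apply: (le_trans (W_le _ _ _ _ mu1 nu1 lm cgamma)).
have : \int[gamma]_z m_ n z.1 z.2 @[n --> \oo] --> \int[gamma]_z m z.1 z.2.
  apply: (@Rintegral01_cvg _ _ _ gamma (probability_setT gamma)
    (fun n z => m_ n z.1 z.2) (fun z => m z.1 z.2)).
  - by move=> n; exact: lsc01_measurable.
  - by move=> n z; exact: (lm_ n).2.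
  - exact: lsc01_measurable.
  - by move=> z; exact: lm.2.
  - by move=> z; exact: m_m.
move=> /cvgr_to_le; apply; apply: nearW => n.
apply/ler_addgt0Pr => e e0; apply: gammaP; [exact: (lm_ n).1|exact: (lm_ n).2|].
near=> k.
apply: (@le_trans _ _ (\int[g k]_z m_ k z.1 z.2)).
  apply: (le_Rintegral01 (g k) (probability_setT (g k))) => //.
  - exact: lsc01_measurable.
  - by move=> z; exact: (lm_ n).2.
  - exact: lsc01_measurable.
  - by move=> z; exact: (lm_ k).2.
  - by move=> z; apply: m_nd; near: k; exists n.
apply: ltW; apply: (lt_trans (gP k).2); rewrite ltrD2l.
by near: k; exact: (near_infty_natSinv_lt (PosNum e0)).
Unshelve. all: by end_near. Qed.

(** By [open_seq], sequences suffice. If [W] stayed at most [a] along a sequence tending to [z], a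
    limit of nearly optimal couplings would be a coupling at [z] of cost at most [a]. *)
Lemma W_lsc m (mu_ nu_ : E -> {measure set (borel E) -> \bar R}) :
  (forall x, mu_ x setT = 1%E) -> (forall x, nu_ x setT = 1%E) ->
  (forall (u : nat -> E) x, u @ \oo --> x -> weak_cvg (mu_ \o u) (mu_ x)) ->
  (forall (u : nat -> E) x, u @ \oo --> x -> weak_cvg (nu_ \o u) (nu_ x)) ->
  lsc01 m -> forall a, open [set z : E * E | a < W m (mu_ z.1) (nu_ z.2)].
Proof.
move=> mu1 nu1 wmu wnu lm a.
apply: open_seq; first exact: second_countable_prod.
move=> u z /= az uz; apply: contrapT => nW.
have Wa n : W m (mu_ (u n).1) (nu_ (u n).2) <= a.
  by rewrite leNgt; apply/negP => h; apply: nW; exists n.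
move: az; rewrite ltNge => /negP; apply.
have /choice[g gP] n : exists g, couplings (mu_ (u n).1) (nu_ (u n).2) g /\
    \int[g]_z m z.1 z.2 < a + n.+1%:R^-1.
  have [|g cg hg] := W_adherent m _ _ n.+1%:R^-1 (mu1 (u n).1) (nu1 (u n).2) lm.
    by rewrite invr_gt0.
  by exists g; split => //; apply: (lt_le_trans hg); rewrite lerD2r.
have u1 : fst \o u @ \oo --> z.1 by apply: cvg_comp uz _; exact: cvg_fst.
have u2 : snd \o u @ \oo --> z.2 by apply: cvg_comp uz _; exact: cvg_snd.
have [gamma cgamma gammaP] := coupling_limit hE_loc hE_haus hE_count
  _ _ _ _ g (fun n => mu1 (u n).1) (mu1 z.1) (wmu _ _ u1)
  (fun n => nu1 (u n).2) (nu1 z.2) (wnu _ _ u2) (fun n => (gP n).1).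
apply: (le_trans (W_le _ _ _ _ (mu1 _) (nu1 _) lm cgamma)).
apply/ler_addgt0Pr => e e0; apply: gammaP; [exact: lm.1|exact: lm.2|].
near=> k; apply: ltW; apply: (lt_trans (gP k).2); rewrite ltrD2l.
by near: k; exact: (near_infty_natSinv_lt (PosNum e0)).
Unshelve. all: by end_near. Qed.

End transport_cost.

(** * The functional and its iterates *)

Section functional.
Context {R : realType} {E : ptopologicalType}.
Hypotheses (hE_loc : locally_compact [set: E]) (hE_haus : hausdorff_space E)
  (hE_count : @second_countable E).
Variables (X : CTMP R E) (c : R).
Hypotheses (hc0 : 0 < c) (hc1 : c < 1).
Implicit Types m : E -> E -> R.

Let P1 t x : ctmp_kernel X t x [set: borel E] = 1%E.
Proof. exact: prob_kernel. Qed.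

Let ct_gt0 (t : R) : 0 < c `^ t. Proof. exact: powR_gt0. Qed.

(** As [c < 1], the discount is at most 1 for [t >= 0]; this makes the supremum defining [Fc] a
    genuine one. *)
Let cW01 m t x y : lsc01 m -> 0 <= t ->
  0 <= c `^ t * W m (ctmp_kernel X t x) (ctmp_kernel X t y) <= 1.
Proof.
move=> lm t0.
have /andP[W0 W1] := W01 hE_count m _ _ (P1 t x) (P1 t y) lm.
rewrite mulr_ge0 ?(ltW (ct_gt0 _))//= -[leRHS]mulr1 ler_pM//.
  exact/ltW/ct_gt0.
by rewrite -(powRr0 c) ger_powR// hc0 ltW.
Qed.

Let Fc_ubound m x y : lsc01 m -> has_ubound
  [set c `^ t * W m (ctmp_kernel X t x) (ctmp_kernel X t y) | t in [set t : R | 0 <= t]].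
Proof.
by move=> lm; exists 1 => _ [t t0 <-]; case/andP: (cW01 m t x y lm t0).
Qed.

Lemma Fc_ge m x y t : lsc01 m -> 0 <= t ->
  c `^ t * W m (ctmp_kernel X t x) (ctmp_kernel X t y) <= Fc X c m x y.
Proof. by move=> lm t0; apply: ub_le_sup; [exact: Fc_ubound|exists t]. Qed.

Lemma Fc_le m x y (a : R) : (forall t, 0 <= t ->
    c `^ t * W m (ctmp_kernel X t x) (ctmp_kernel X t y) <= a) ->
  Fc X c m x y <= a.
Proof.
move=> h; apply: ge_sup => [|_ [t t0 <-]]; last exact: h.
by eexists; exists 0 => /=.
Qed.

(** A strict superlevel set of a supremum is the union of those of its terms, and [W_lsc] makes each
    of them open. *)
Lemma Fc_lsc01 m : lsc01 m -> lsc01 (Fc X c m).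
Proof.
move=> lm; split=> [a|x y]; last first.
  apply/andP; split; last by apply: Fc_le => t t0; case/andP: (cW01 m t x y lm t0).
  apply: le_trans (Fc_ge _ _ _ _ lm (lexx 0)).
  by case/andP: (cW01 m 0 x y lm (lexx 0)).
rewrite (_ : [set z | _] = \bigcup_(t in [set t : R | 0 <= t])
    [set z : E * E | a / c `^ t < W m (ctmp_kernel X t z.1) (ctmp_kernel X t z.2)]).
  apply: bigcup_open => t t0.
  apply: (W_lsc hE_loc hE_haus hE_count m (ctmp_kernel X t) (ctmp_kernel X t)) => //.
  - by move=> u x ux; exact: ctmp_kernel_cvg.
  - by move=> u x ux; exact: ctmp_kernel_cvg.
apply/seteqP; split => [z /= h|z [t t0 /=]].
  have [|_ [t t0 <-] at_] := sup_gt _ h; first by eexists; exists 0 => /=.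
  by exists t => //=; rewrite ltr_pdivrMr// mulrC.
rewrite ltr_pdivrMr// mulrC => /lt_le_trans; apply; exact: Fc_ge.
Qed.

Lemma le_Fc m1 m2 : lsc01 m1 -> lsc01 m2 -> (forall x y, m1 x y <= m2 x y) ->
  forall x y, Fc X c m1 x y <= Fc X c m2 x y.
Proof.
move=> lm1 lm2 m12 x y; apply: Fc_le => t t0.
apply: le_trans (Fc_ge _ _ _ _ lm2 t0).
by rewrite ler_pM2l//; apply: le_W.
Qed.

Lemma delta_lsc01 n : lsc01 (delta X c n).
Proof.
elim: n => [|n ih]; last exact: Fc_lsc01.
have c_obs : continuous (ctmp_obs X) by exact: ctmp_obs_continuous.
split=> [a|x y] /=; last first.
  have := ctmp_obs01 X x; have := ctmp_obs01 X y => /andP[? ?] /andP[? ?].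
  by rewrite normr_ge0/= ler_norml; apply/andP; split; lra.
rewrite (_ : [set z | _] =
  (fun z : E * E => `|ctmp_obs X z.1 - ctmp_obs X z.2|) @^-1` [set y | a < y])//.
apply: open_comp; last exact: open_gt.
move=> z _; apply: cvg_norm; apply: cvgB.
  by apply: cvg_comp; [exact: cvg_fst|exact: c_obs].
by apply: cvg_comp; [exact: cvg_snd|exact: c_obs].
Qed.

(** The semigroup is the identity at time 0, so both measures integrate every [C0] function to its
    value at [x]. *)
Lemma kernel0_dirac x (A : set (borel E)) : measurable A ->
  ctmp_kernel X 0 x A = \d_(x : borel E) A.
Proof.
move=> mA; apply: (C0_measure_unique hE_loc hE_haus hE_count) => //.
  exact: diracT.
move=> f Cf _; rewrite -(ctmp_kernelE X) //.
rewrite (semigroup0 (ctmp_semigroupP X))//.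
rewrite /Rintegral integral_dirac//; last first.
  by apply/measurable_EFinP; apply: continuous_borel; case: Cf.
by rewrite diracT mul1e.
Qed.

(** The term [t = 0] of the supremum already suffices: for any coupling of the Dirac marginals, the
    integral of the difference of the observations is [obs x - obs y], and its absolute value is at
    most the integral of the absolute value. *)
Lemma delta0_le x y : delta X c 0 x y <= delta X c 1 x y.
Proof.
apply: le_trans (Fc_ge _ _ _ _ (delta_lsc01 0) (lexx 0)).
rewrite powRr0 mul1r; apply: W_ge => // g cg.
have m_obs : measurable_fun [set: borel E] (ctmp_obs X).
  by apply: continuous_borel; exact: ctmp_obs_continuous.
have obs0 z : 0 <= ctmp_obs X z by case/andP: (ctmp_obs01 X z).
have g1 : g [set: borel E * borel E] = 1%E by exact: probability_setT.
have marg (p : borel E * borel E -> borel E) w : measurable_fun setT p ->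
    (forall A, measurable A -> g (p @^-1` A) = ctmp_kernel X 0 w A) ->
    \int[g]_z ctmp_obs X (p z) = ctmp_obs X w.
  move=> mp gp; rewrite (Rintegral_marginal g (\d_(w : borel E)) p)//.
    rewrite /Rintegral integral_dirac//; last exact/measurable_EFinP.
    by rewrite diracT mul1e.
  by move=> A mA; rewrite gp// kernel0_dirac.
have iobs (p : borel E * borel E -> borel E) : measurable_fun setT p ->
    g.-integrable setT (EFin \o (fun z => ctmp_obs X (p z))).
  move=> mp; apply: (integrable01 g g1); last by move=> z; exact: ctmp_obs01.
  exact: measurableT_comp.
rewrite /= -(marg fst x)//; last by move=> A mA; have [] := cg A mA.
rewrite -(marg snd y)//; last by move=> A mA; have [] := cg A mA.
rewrite -RintegralB//; [|exact: iobs|exact: iobs].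
apply: le_normr_Rintegral => //.
exact: (integrableB measurableT (iobs _ measurable_fst) (iobs _ measurable_snd)).
Qed.

Lemma deltaS_le n x y : delta X c n x y <= delta X c n.+1 x y.
Proof.
elim: n x y => [|n ih] x y; first exact: delta0_le.
by apply: le_Fc; [exact: (delta_lsc01 n)|exact: (delta_lsc01 n.+1)|exact: ih].
Qed.

Lemma delta_nd x y : {homo (fun n => delta X c n x y) : n k / (n <= k)%N >-> n <= k}.
Proof. by apply/nondecreasing_seqP => n; exact: deltaS_le. Qed.

Lemma delta_ubound x y : has_ubound [set delta X c n x y | n in [set: nat]].
Proof. by exists 1 => _ [n _ <-]; case/andP: ((delta_lsc01 n).2 x y). Qed.

Lemma delta_le_bar n x y : delta X c n x y <= delta_bar X c x y.
Proof. by apply: ub_le_sup; [exact: delta_ubound|exists n]. Qed.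

Lemma delta_bar_le x y (a : R) : (forall n, delta X c n x y <= a) ->
  delta_bar X c x y <= a.
Proof. by move=> h; apply: ge_sup => [|_ [n _ <-]//]; eexists; exists 0%N. Qed.

Lemma delta_bar_lsc01 : lsc01 (delta_bar X c).
Proof.
split=> [a|x y]; last first.
  apply/andP; split.
    by apply: le_trans (delta_le_bar 0 x y); case/andP: ((delta_lsc01 0).2 x y).
  by apply: delta_bar_le => n; case/andP: ((delta_lsc01 n).2 x y).
rewrite (_ : [set z | _] = \bigcup_n [set z : E * E | a < delta X c n z.1 z.2]).
  by apply: bigcup_open => n _; exact: (delta_lsc01 n).1.
apply/seteqP; split => [z /= h|z [n _ /= h]]; last first.
  exact: (lt_le_trans h (delta_le_bar _ _ _)).
have [|_ [n _ <-] an] := sup_gt _ h; first by eexists; exists 0%N.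
by exists n.
Qed.

End functional.

Theorem theorem1 (R : realType) (E : ptopologicalType)
    (hE_loc : locally_compact [set: E]) (hE_haus : hausdorff_space E)
    (hE_count : @second_countable E)
    (X : CTMP R E) (c : R) (hc0 : 0 < c) (hc1 : c < 1) :
  Fc X c (delta_bar X c) = delta_bar X c.
Proof.
have ldn n := delta_lsc01 hE_loc hE_haus hE_count X c hc0 hc1 n.
have ldb := delta_bar_lsc01 hE_loc hE_haus hE_count X c hc0 hc1.
apply/funext => x; apply/funext => y; apply/eqP; rewrite eq_le; apply/andP; split.
  (* For fixed [t], after division by [c ^ t], [W_cvg_le] reduces the bound to each [delta n], where
     the discounted cost is at most [delta n.+1], hence at most [delta_bar]. *)
  apply: Fc_le => t t0; have ct0 : 0 < c `^ t by exact: powR_gt0.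
  rewrite mulrC -ler_pdivlMr//.
  apply: (@W_cvg_le _ _ hE_loc hE_haus hE_count (delta X c)) => //.
  - exact: prob_kernel.
  - exact: prob_kernel.
  - exact: delta_nd.
  - move=> x' y'; apply: nondecreasing_cvgn; first exact: delta_nd.
    exact: delta_ubound.
  - move=> n; rewrite ler_pdivlMr// mulrC.
    apply: le_trans (delta_le_bar hE_loc hE_haus hE_count X c hc0 hc1 n.+1 x y).
    exact: Fc_ge.
(* Conversely, [delta n <= delta n.+1 = Fc (delta n) <= Fc delta_bar]. *)
apply: delta_bar_le => n.
apply: le_trans (deltaS_le hE_loc hE_haus hE_count X c hc0 hc1 n x y) _.
apply: le_Fc => // x' y'; exact: delta_le_bar.
Qed.
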